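(* Let $N\ge 1$, $s\in(0,1)$, $\alpha_1,\alpha_2\in\mathbb{R}$, and let $\gamma:=s-\alpha_1-\alpha_2$. Let $\Phi$ be an Orlicz function. If $\gamma>N/p_\Phi^\ominus$, then there exists a constant $C>0$ such that $$\int_{\mathbb{R}^N}\Phi\left(\frac{|u(x)|}{|x|^\gamma}\right)dx\le C\int_{\mathbb{R}^N}\int_{\mathbb{R}^N}\Phi\left(|x|^{\alpha_1}|y|^{\alpha_2}|D_su(x,y)|\right)d\mu\qquad\text{for all } u\in\mathcal{C}_c^1(\mathbb{R}^N\setminus\{0\}).$$
   Context: An Orlicz function is a continuous convex function $\Phi:[0,\infty)\to[0,\infty)$ such that $\lim_{t\to0}\Phi(t)/t=0$, $\lim_{t\to\infty}\Phi(t)/t=\infty$, and there is a constant $C>0$ with $\Phi(2t)\le C\Phi(t)$ for all $t\ge0$ (the $\Delta_2$-condition). Such a $\Phi$ can be written $\Phi(t)=\int_0^t\varphi(s)\,ds$, where $\varphi$ (the right derivative of $\Phi$) is non-decreasing and right continuous on $[0,\infty)$, $\varphi(0)=0$, $\varphi(t)>0$ for $t>0$, and $\lim_{t\to\infty}\varphi(t)=\infty$. Define $p_\Phi^-:=\inf_{t>0}\frac{t\varphi(t)}{\Phi(t)}$. Two Orlicz functions $\Phi,\Psi$ are equivalent, written $\Phi\asymp\Psi$, if there are $C_1,C_2>0$ with $C_1\Phi(t)\le\Psi(t)\le C_2\Phi(t)$ for all $t\ge0$. Define $p_\Phi^\ominus:=\sup\{p_\Psi^-:\Psi\text{ Orlicz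 function},\ \Psi\asymp\Phi\}$. $\mathcal{C}_c^1(\Omega)$ is the set of continuously differentiable functions with compact support in $\Omega$; functions in $\mathcal{C}_c^1(\mathbb{R}^N\setminus\{0\})$ are extended by $0$ at the origin. For a continuous $u$, $D_su(x,y):=\frac{u(x)-u(y)}{|x-y|^s}$, and $d\mu:=\frac{dx\,dy}{|x-y|^N}$ on $\mathbb{R}^N\times\mathbb{R}^N$. *)

(* Defs.v *)
From HB Require Import structures.
From mathcomp Require Import all_boot all_order all_algebra.
From mathcomp Require Import all_classical all_reals all_analysis.

Set Implicit Arguments.
Unset Strict Implicit.
Unset Printing Implicit Defensive.

Import Order.TTheory GRing.Theory Num.Theory.
Import numFieldNormedType.Exports.

Local Open Scope classical_set_scope.
Local Open Scope ring_scope.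

(* 'rV[T]_n carries the sigma-algebra generated by its n coordinates, as
   n.-tuple T does in the library; for T := R it is the Borel one. *)
Section measurable_rV.
Context {d : measure_display} {T : sigmaRingType d}.
Variable n : nat.

Let coors : 'I_n -> 'rV[T]_n -> T := fun i x => x ord0 i.

Let rV_set0 : g_sigma_preimage coors set0.
Proof. exact: sigma_algebra0. Qed.

Let rV_setC A : g_sigma_preimage coors A -> g_sigma_preimage coors (~` A).
Proof. exact: sigma_algebraC. Qed.

Let rV_bigcup (F : _^nat) : (forall i, g_sigma_preimage coors (F i)) ->
  g_sigma_preimage coors (\bigcup_i (F i)).
Proof. exact: sigma_algebra_bigcup. Qed.

HB.instance Definition _ := @isMeasurable.Build (measure_tuple_display d)
  'rV[T]_n (g_sigma_preimage coors) rV_set0 rV_setC rV_bigcup.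

End measurable_rV.

Lemma measurable_coord d (T : sigmaRingType d) n (i : 'I_n) :
  measurable_fun [set: 'rV[T]_n] (fun x : 'rV[T]_n => x ord0 i).
Proof.
move=> _ Y mY; rewrite setTI; apply: sub_sigma_algebra => /=.
rewrite -bigcup_seq/=; exists i => /=; first by rewrite mem_index_enum.
by exists Y => //; rewrite setTI.
Qed.

Lemma measurable_fun_coord d1 d2 (T1 : measurableType d1)
    (T2 : measurableType d2) n (f : T1 -> 'rV[T2]_n) :
  (forall i, measurable_fun [set: T1] (fun x => f x ord0 i)) ->
  measurable_fun [set: T1] f.
Proof.
move=> mf.
suff : g_sigma_preimage (fun i : 'I_n => (fun x : 'rV[T2]_n => x ord0 i) \o f)
    `<=` measurable.
  by rewrite g_sigma_preimage_comp => prefS _ A mA; apply: prefS; exists A.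
apply: smallest_sub; first exact: sigma_algebra_measurable.
move=> A; rewrite -bigcup_seq/= => -[i _] [B mB <-]; exact: mf.
Qed.

Section lebesgue_rV.
Context {R : realType}.

Definition rV_cons n (p : R * 'rV[R]_n) : 'rV[R]_n.+1 :=
  \row_i (if unlift ord0 i is Some j then p.2 ord0 j else p.1).

Lemma measurable_rV_cons n : measurable_fun [set: R * 'rV[R]_n] (@rV_cons n).
Proof.
apply: measurable_fun_coord => i.
under eq_fun do rewrite mxE.
case: (unlift ord0 i) => [j|]; last exact: measurable_fst.
exact: (measurableT_comp (measurable_coord j) measurable_snd).
Qed.

Section step.
Variables (n : nat) (m : {sigma_finite_measure set 'rV[R]_n -> \bar R}).

Definition lebesgue_step : set 'rV[R]_n.+1 -> \bar R :=
  pushforward (lebesgue_measure \x m)%E (@rV_cons n).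

Let preimage_measurable (A : set 'rV[R]_n.+1) : measurable A ->
  measurable (@rV_cons n @^-1` A).
Proof. by move=> mA; rewrite -[X in measurable X]setTI; exact: measurable_rV_cons. Qed.

Let lebesgue_step0 : lebesgue_step set0 = 0%E.
Proof. by rewrite /lebesgue_step /pushforward preimage_set0 measure0. Qed.

Let lebesgue_step_ge0 A : (0 <= lebesgue_step A)%E.
Proof. by apply: integral_ge0 => x _; exact: measure_ge0. Qed.

Let lebesgue_step_sigma_additive : semi_sigma_additive lebesgue_step.
Proof.
move=> F mF tF mUF; rewrite /lebesgue_step /pushforward preimage_bigcup.
apply: (@measure_semi_sigma_additive _ _ _ (lebesgue_measure \x m)%E).
- by move=> k; exact: preimage_measurable.
- apply/trivIsetP => /= i j _ _ ij; rewrite -preimage_setI.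
  by move/trivIsetP : tF => /(_ _ _ _ _ ij) ->//; rewrite preimage_set0.
- by rewrite -preimage_bigcup; exact: preimage_measurable.
Qed.

HB.instance Definition _ := isMeasure.Build _ _ _ lebesgue_step
  lebesgue_step0 lebesgue_step_ge0 lebesgue_step_sigma_additive.

Let uncons (x : 'rV[R]_n.+1) : R * 'rV[R]_n :=
  (x ord0 ord0, \row_i x ord0 (lift ord0 i)).

Let uncons_measurable : measurable_fun [set: 'rV[R]_n.+1] uncons.
Proof.
apply/measurable_fun_pairP; split; first exact: measurable_coord.
apply: measurable_fun_coord => i /=.
by under eq_fun do rewrite mxE; exact: measurable_coord.
Qed.

Let rV_consK : cancel (@rV_cons n) uncons.
Proof.
case=> a x; rewrite /uncons mxE unlift_none/=; congr pair.
by apply/rowP => i; rewrite !mxE liftK.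
Qed.

Let lebesgue_step_sigma_finite : sigma_finite setT lebesgue_step.
Proof.
have /sigma_finiteP[F [TF ndF Foo]] := sigma_finiteT (@lebesgue_measure R).
have /sigma_finiteP[G [TG ndG Goo]] := sigma_finiteT m.
exists (fun k => uncons @^-1` (F k `*` G k)).
  rewrite -preimage_bigcup (_ : \bigcup_k _ = setT) ?preimage_setT//.
  rewrite -setXTT TF TG predeqE => -[x y]; split.
    by move=> [k _ []/= ? ?]; split; exists k.
  move=> [/= [k _ Fkx] [l _ Gly]]; exists (maxn k l) => //; split.
    by move: x Fkx; exact/subsetPset/ndF/leq_maxl.
  by move: y Gly; exact/subsetPset/ndG/leq_maxr.
move=> k; have [mF Fk] := Foo k; have [mG Gk] := Goo k; split.
  rewrite -[X in measurable X]setTI; apply: uncons_measurable => //.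
  exact: measurableX.
rewrite /lebesgue_step /pushforward -comp_preimage.
rewrite (_ : uncons \o _ = id); last by apply/funext => p; exact: rV_consK.
by rewrite preimage_id product_measure1E// lte_mul_pinfty// ge0_fin_numE.
Qed.

HB.instance Definition _ := Measure_isSigmaFinite.Build _ _ _ lebesgue_step
  lebesgue_step_sigma_finite.

End step.

Fixpoint lebesgue_rV n : {sigma_finite_measure set 'rV[R]_n -> \bar R} :=
  if n is k.+1 then lebesgue_step (lebesgue_rV k) else \d_(0 : 'rV[R]_0).

End lebesgue_rV.

Lemma lebesgue_rV_box (R : realType) n (A : 'I_n -> set (measurableTypeR R)) :
  (forall i, measurable (A i)) ->
  lebesgue_rV n [set x : 'rV[R]_n | forall i, A i (x ord0 i)] =
  (\prod_(i < n) lebesgue_measure (A i))%E.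
Proof.
elim: n A => [|n IH] A mA.
  by rewrite big_ord0 /= diracE mem_set// => -[].
set B := [set x : 'rV[R]_n | forall i, A (lift ord0 i) (x ord0 i)].
have mB : measurable B.
  rewrite (_ : B = \bigcap_(i in [set: 'I_n])
      (fun x : 'rV[R]_n => x ord0 i) @^-1` A (lift ord0 i)).
    apply: fin_bigcap_measurable => // i _.
    rewrite -[X in measurable X]setTI.
    exact: (measurable_coord i measurableT (mA _)).
  by apply/seteqP; split=> x h i //=; exact: h.
rewrite big_ord_recl -IH//= -/B -product_measure1E// /lebesgue_step /pushforward.
congr (product_measure1 _ _ _); apply/seteqP; split=> -[a x] /=.
  move=> h; split; first by have := h ord0; rewrite mxE unlift_none.
  by move=> i; have := h (lift ord0 i); rewrite mxE liftK.
by move=> [Aa Ax] i; rewrite mxE; case: unliftP => [j|] ->.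
Qed.

(* The norm `|x| of 'rV[R]_n is the sup norm; the Euclidean norm is needed. *)
Definition enorm {R : realType} n (x : 'rV[R]_n) : R :=
  Num.sqrt (\sum_i x ord0 i ^+ 2).

(* For open Omega; a function on Omega is represented by its extension by 0. *)
Definition Cc1 {R : realType} n (Omega : set 'rV[R]_n) (u : 'rV[R]_n -> R) :=
  [/\ forall x, Omega x -> differentiable u x,
      forall v x, Omega x -> {for x, continuous (fun y => 'D_v u y)},
      compact (closure [set x | u x != 0]) &
      closure [set x | u x != 0] `<=` Omega].

Definition Ds {R : realType} n (s : R) (u : 'rV[R]_n -> R) (x y : 'rV[R]_n) : R :=
  (u x - u y) / enorm (x - y) `^ s.

(* A function on [0, +oo[ is represented by a function on R, only the values of
   which on [0, +oo[ are ever used. *)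
Section orlicz.
Context {R : realType}.
Implicit Types Phi Psi : R -> R.

Record orlicz_function Phi : Prop := OrliczFunction {
  orlicz_ge0 : forall t, 0 <= t -> 0 <= Phi t ;
  orlicz_continuous : {within `[0, +oo[%classic, continuous Phi} ;
  orlicz_convex : convex_function (`[0, +oo[%classic : set R) Phi ;
  orlicz_cvg0 : Phi t / t @[t --> 0^'+] --> (0 : R) ;
  orlicz_cvgy : Phi t / t @[t --> +oo] --> +oo ;
  orlicz_Delta2 : exists2 C : R, 0 < C &
    forall t, 0 <= t -> Phi (2 * t) <= C * Phi t }.

Definition right_derive Phi (t : R) : R :=
  lim ((Phi (t + h) - Phi t) / h @[h --> 0^'+]).

Definition p_minus Phi : R :=
  inf [set t * right_derive Phi t / Phi t | t in [set t : R | 0 < t]].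

Definition orlicz_equiv Phi Psi : Prop :=
  exists C1 C2 : R, [/\ 0 < C1, 0 < C2 &
    forall t, 0 <= t -> C1 * Phi t <= Psi t /\ Psi t <= C2 * Phi t].

(* The set is nonempty and bounded above (by the Delta_2 condition), so that
   the supremum in R is the genuine one. *)
Definition p_ominus Phi : R :=
  sup [set p_minus Psi | Psi in
    [set Psi | orlicz_function Psi /\ orlicz_equiv Psi Phi]].

End orlicz.

(* Main.v *)
Require Import Defs.
From HB Require Import structures.
From mathcomp Require Import all_boot all_order all_algebra.
From mathcomp Require Import all_classical all_reals all_analysis.
From mathcomp Require Import measurable_realfun ring lra.

(** The inequality is obtained by comparing u at x with u at points y that are
    closer to the origin by a small factor of order a, and by absorbing the
    resulting term into the left-hand side.

    The quantity p_minus controls decay: t phi(t) >= p Phi(t) makes Phi grow at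
    least like the power p, hence Phi (l t) <= eps l^d Phi t for suitable small
    l, for every d < p and eps > 0 (orlicz_decay). An Orlicz function
    equivalent to Phi may replace Phi at the cost of constants, and one of them
    has p > N / gamma (p_ominus_witness); let Phi denote that one.

    To x attach the cube of the points y whose coordinates all lie between
    a |x| and 2 a |x|. For such y, convexity and
    |u x| <= |u x - u y| + |u y| bound the density
    E x = Phi (|u x| / |x|^gamma) by the sum of two terms (hardy_pointwise).
    - The oscillation Phi (2 |u x - u y| / |x|^gamma). On the cube |x| and |y|
      are comparable and |x - y| is at most a multiple of |x|; as
      gamma = s - alpha1 - alpha2, the Delta_2 condition bounds this term,
      divided by the volume (a |x|)^N of the cube, by a constant times the
      integrand of the right-hand side.
    - The tail Phi (2 |u y| / |x|^gamma). Here |y| is at most a multiple c a |x|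
      of |x|, so this is at most Phi (2 (c a)^gamma t) for
      t = |u y| / |y|^gamma, hence at most kappa (E y) with kappa much smaller than
      (a^gamma)^(N / gamma) = a^N (orlicz_small_cube).

    Now average over the cube and integrate in x. By Tonelli's theorem the tail
    contributes at most kappa times the integral of E times the mass in x of the
    averaging kernel, which is at most (4 / a)^N (integral_cube_kernel_l). Since
    kappa beats a^N, the tail is at most half of the integral of E, and that
    integral is finite because the support of u is a compact set avoiding the
    origin (energy_lty); so the tail is absorbed (kernel_absorption). *)

Set Implicit Arguments.
Unset Strict Implicit.
Unset Printing Implicit Defensive.

Import Order.TTheory GRing.Theory Num.Theory.
Import numFieldNormedType.Exports.

Local Open Scope classical_set_scope.
Local Open Scope ring_scope.

(** * Orlicz functions and their growth *)

Section orlicz.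
Context {R : realType} {Phi : R -> R} (oPhi : orlicz_function Phi).

Lemma orlicz_conv (t x y : R) : 0 <= t <= 1 -> 0 <= x -> 0 <= y ->
  Phi (t * x + (1 - t) * y) <= t * Phi x + (1 - t) * Phi y.
Proof.
move=> /andP[t0 t1] x0 y0.
by apply: (orlicz_convex oPhi (Itv01 t0 t1)); rewrite inE/= in_itv/= ?x0 ?y0.
Qed.

Lemma orlicz0 : Phi 0 = 0.
Proof.
have /continuous_within_itvcyP[_ P0] := orlicz_continuous oPhi.
have : Phi t / t * t @[t --> 0^'+] --> (0 * 0 : R).
  by apply: cvgM; [exact: orlicz_cvg0|exact: cvg_at_right_filter].
rewrite mul0r => P1.
apply: (@cvg_unique _ _ (Phi t @[t --> (0:R)^'+])) => //.
apply: cvg_trans P1; apply: near_eq_cvg; near=> t.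
by rewrite divfK//; near: t; exact: nbhs_right_neq.
Unshelve. all: by end_near. Qed.

Lemma orlicz_le_scale (t x : R) : 0 <= t <= 1 -> 0 <= x ->
  Phi (t * x) <= t * Phi x.
Proof.
move=> t01 x0; have := orlicz_conv t01 x0 (lexx 0).
by rewrite orlicz0 !mulr0 !addr0.
Qed.

Lemma orlicz_homo (x y : R) : 0 <= x -> x <= y -> Phi x <= Phi y.
Proof.
move=> x0 xy; have [y0|y0] := leP y 0; first by rewrite (_ : x = y)//; lra.
have t01 : 0 <= x / y <= 1 by rewrite divr_ge0 ?(ltW y0)// ler_pdivrMr// mul1r.
have := orlicz_le_scale t01 (ltW y0); rewrite divfK ?gt_eqF// => /le_trans.
apply.
by rewrite ler_piMl ?(orlicz_ge0 oPhi) ?(ltW y0)//; case/andP: t01.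
Qed.

Lemma orlicz_le_mul (M : R) : 0 <= M -> exists2 C : R, 0 < C &
  forall t : R, 0 <= t -> Phi (M * t) <= C * Phi t.
Proof.
move=> M0; have [C C0 PC] := orlicz_Delta2 oPhi.
have PCn n (t : R) : 0 <= t -> Phi (2 ^+ n * t) <= C ^+ n * Phi t.
  move=> t0; elim: n => [|n IH]; first by rewrite !expr0 !mul1r.
  rewrite exprS -mulrA (le_trans (PC _ _))// ?mulr_ge0 ?exprn_ge0//.
  by rewrite exprS -mulrA ler_pM2l.
have Mn : M <= 2 ^+ Num.bound M.
  rewrite ltW// (lt_trans (archi_boundP M0))//.
  by rewrite -natrX ltr_nat ltn_expl.
exists (C ^+ Num.bound M) => [|t t0]; first exact: exprn_gt0.
apply: le_trans (PCn _ _ t0).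
by apply: orlicz_homo; rewrite ?mulr_ge0// ler_wpM2r.
Qed.

(** A zero at some t > 0 would spread to all of [0, +oo[ by the Delta_2
    condition, against the growth of Phi at infinity. *)
Lemma orlicz_gt0 (t : R) : 0 < t -> 0 < Phi t.
Proof.
move=> t0; rewrite lt_neqAle (orlicz_ge0 oPhi) ?ltW// andbT.
apply/eqP => Pt.
have [A [_ HA]] : \forall x \near +oo, 1 <= Phi x / x.
  by have /cvgryPge := orlicz_cvgy oPhi; apply.
pose x := Num.max 1 (A + 1).
have x0 : 0 < x by rewrite lt_max ltr01.
have [C _ PC] := orlicz_le_mul (ltW (divr_gt0 x0 t0)).
have := PC _ (ltW t0); rewrite -Pt mulr0 divfK ?gt_eqF//.
have : 1 <= Phi x / x by apply: HA; rewrite lt_max ltrDl ltr01 orbT.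
by rewrite ler_pdivlMr// mul1r; move: x0; clear; lra.
Qed.

Let slope (t h : R) := (Phi (t + h) - Phi t) / h.

Let slope_ge t h : 0 < t -> 0 < h -> Phi t / t <= slope t h.
Proof.
move=> t0 h0; rewrite /slope ler_pdivlMr// [leLHS]mulrAC ler_pdivrMr//.
have th : 0 < t + h by lra.
have t01 : 0 <= t / (t + h) <= 1.
  by rewrite divr_ge0 ?(ltW t0) ?(ltW th)// ler_pdivrMr// mul1r; lra.
have := orlicz_le_scale t01 (ltW th); rewrite divfK ?gt_eqF//.
by rewrite mulrAC ler_pdivlMr//; lra.
Qed.

Let slope_homo t h k : 0 < t -> 0 < h -> h <= k -> slope t h <= slope t k.
Proof.
move=> t0 h0 hk; have k0 : 0 < k by lra.
rewrite /slope ler_pdivlMr// [leLHS]mulrAC ler_pdivrMr//.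
have h01 : 0 <= h / k <= 1.
  by rewrite divr_ge0 ?(ltW k0) ?(ltW h0)//= ler_pdivrMr ?mul1r.
have tk : 0 <= t + k by lra.
have := orlicz_conv h01 tk (ltW t0).
have -> : h / k * (t + k) + (1 - h / k) * t = t + h by field; rewrite gt_eqF.
have -> : h / k * Phi (t + k) + (1 - h / k) * Phi t =
  (h * Phi (t + k) + (k - h) * Phi t) / k by field; rewrite gt_eqF.
by rewrite ler_pdivlMr//; lra.
Qed.

(** By convexity the slopes h |-> (Phi (t + h) - Phi t) / h increase with h and
    are bounded below by the slope Phi t / t of the chord from 0; hence the
    limit in the definition of the right derivative exists and is their
    infimum. *)
Lemma right_derive_bounds (t : R) : 0 < t -> Phi t / t <= right_derive Phi t /\
  forall h : R, 0 < h -> right_derive Phi t <= (Phi (t + h) - Phi t) / h.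
Proof.
move=> t0; have lb : lbound [set slope t h | h in `]0, +oo[%classic] (Phi t / t).
  by move=> _ [h /= + <-]; rewrite in_itv/= andbT; exact: slope_ge.
rewrite /right_derive (_ : lim _ = inf [set slope t h | h in `]0, +oo[%classic]).
  split.
    apply: lb_le_inf => //.
    by exists (slope t 1); exists 1 => //=; rewrite in_itv/= ltr01.
  move=> h h0; apply: ge_inf; first by exists (Phi t / t).
  by exists h => //=; rewrite in_itv/= h0.
apply: cvg_lim => //.
apply: nondecreasing_at_right_cvgr => //; last by exists (Phi t / t).
move=> h k; rewrite !in_itv/= !andbT => h0 k0 hk; exact: slope_homo.
Qed.

Let p_minus_lbound :
  lbound [set t * right_derive Phi t / Phi t | t in [set t : R | 0 < t]] 1.
Proof.
move=> _ [t /= t0 <-]; rewrite ler_pdivlMr ?orlicz_gt0// mul1r mulrC.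
by rewrite -ler_pdivrMr//; exact: (right_derive_bounds t0).1.
Qed.

Lemma p_minus_ge1 : 1 <= p_minus Phi.
Proof.
apply: lb_le_inf; last exact: p_minus_lbound.
by exists (1 * right_derive Phi 1 / Phi 1); exists 1 => /=.
Qed.

(** The bound t phi(t) >= p Phi(t) is a logarithmic derivative bound; the
    supporting line at t turns it into a multiplicative growth step without
    any integration, and iterating the step recovers a power law. *)
Lemma orlicz_growth (t h : R) : 0 <= t -> 0 <= h ->
  (1 + p_minus Phi * h) * Phi t <= Phi ((1 + h) * t).
Proof.
rewrite le_eqVlt => /predU1P[<- _|t0]; first by rewrite mulr0 orlicz0 mulr0.
rewrite le_eqVlt => /predU1P[<-|h0]; first by rewrite mulr0 addr0 !mul1r.
have : p_minus Phi <= t * right_derive Phi t / Phi t.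
  by apply: ge_inf; [exists 1; exact: p_minus_lbound|exists t].
rewrite ler_pdivlMr ?orlicz_gt0// => H.
have := (right_derive_bounds t0).2 (h * t) (mulr_gt0 h0 t0).
rewrite ler_pdivlMr ?mulr_gt0// => H2.
rewrite !mulrDl !mul1r.
have : p_minus Phi * Phi t * h <= t * right_derive Phi t * h by rewrite ler_pM2r.
by lra.
Qed.

Lemma measurable_orlicz : measurable_fun (`[0, +oo[%classic : set R) Phi.
Proof.
apply: subspace_continuous_measurable_fun => //; exact: orlicz_continuous.
Qed.

Lemma measurable_orlicz_comp d (T : measurableType d) (f : T -> R) :
  (forall x, 0 <= f x) -> measurable_fun setT f ->
  measurable_fun setT (fun x => Phi (f x)).
Proof.
move=> f0 mf.
apply: (@measurable_comp _ _ _ _ _ _ (`[0, +oo[%classic : set R) Phi _ f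
  _ _ measurable_orlicz) => //.
by move=> _ [x _ <-] /=; rewrite in_itv/= f0.
Qed.

End orlicz.

Section orlicz_decay.
Context {R : realType} {Phi : R -> R} (oPhi : orlicz_function Phi).

(** The exponent of decay at scales l -> 0 beats every d < p_minus Phi. Take
    l = exp(-n eta): n growth steps give Phi (l t) <= (1 + p eta)^-n Phi t, and
    l^d = exp(-n d eta), so that the gain is the n-th power of the ratio
    rho = exp(d eta) / (1 + p eta), which is below 1 for small eta. *)
Lemma orlicz_decay (d eps : R) : 0 < d < p_minus Phi -> 0 < eps ->
  exists2 l : R, 0 < l & forall t : R, 0 <= t -> Phi (l * t) <= eps * l `^ d * Phi t.
Proof.
set p := p_minus Phi => /andP[d0 dp] eps0; have p0 : 0 < p by lra.
(* This eta makes (1 + p eta)(1 - d eta) > 1; with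
   exp(d eta) <= 1 / (1 - d eta) this gives rho < 1. *)
pose eta := (p - d) / (2 * p * d).
have pd0 : 0 < 2 * p * d by rewrite !mulr_gt0.
have eta0 : 0 < eta by rewrite divr_gt0 ?subr_gt0.
have peta : 0 < 1 + p * eta by have := mulr_gt0 p0 eta0; lra.
pose rho := expR (d * eta) / (1 + p * eta).
have rho0 : 0 <= rho by rewrite divr_ge0 ?expR_ge0 ?ltW.
have rho1 : rho < 1.
  rewrite ltr_pdivrMr// mul1r.
  have E : d * eta = (p - d) / (2 * p) by rewrite /eta; field; rewrite !gt_eqF.
  have de1 : 0 < 1 - d * eta.
    by rewrite E subr_gt0 ltr_pdivrMr ?mulr_gt0//; lra.
  rewrite -[d * eta]opprK expRN.
  apply: (@le_lt_trans _ _ (1 - d * eta)^-1).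
    by rewrite lef_pV2 ?posrE ?expR_gt0//; exact: expR_ge1Dx.
  rewrite -[ltLHS]mul1r ltr_pdivrMr//.
  have -> : (1 + p * eta) * (1 - d * eta) = 1 + eta * ((p - d) / 2).
    by rewrite /eta; field; rewrite !gt_eqF.
  by rewrite ltrDl mulr_gt0// divr_gt0// subr_gt0.
have [n rhon] : exists n, rho ^+ n <= eps.
  have /cvgr0_norm_le : (GRing.exp rho : R^nat) @ \oo --> 0.
    by apply: cvg_expr; rewrite ger0_norm.
  move=> /(_ _ eps0)[n _ /(_ n (leqnn n))/= H]; exists n.
  exact: le_trans (ler_norm _) H.
have step (t : R) : 0 <= t ->
    (1 + p * eta) ^+ n * Phi t <= Phi (expR (eta *+ n) * t).
  move=> t0; elim: n {rhon} => [|n IH]; first by rewrite mulr0n expR0 expr0 !mul1r.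
  have et0 : 0 <= expR (eta *+ n) * t by rewrite mulr_ge0 ?expR_ge0.
  rewrite exprS -mulrA (le_trans (ler_wpM2l (ltW peta) IH))//.
  rewrite (le_trans (orlicz_growth oPhi et0 (ltW eta0)))//.
  apply: (orlicz_homo oPhi); first by rewrite mulr_ge0// addr_ge0// ltW.
  by rewrite mulrS expRD -mulrA ler_wpM2r// expR_ge1Dx.
exists (expR (- (eta *+ n))) => [|t t0]; first exact: expR_gt0.
have := step (expR (- (eta *+ n)) * t); rewrite mulr_ge0 ?expR_ge0// => /(_ isT).
rewrite mulrA -expRD subrr expR0 mul1r mulrC -ler_pdivlMr ?exprn_gt0//.
move=> /le_trans; apply; rewrite mulrC ler_wpM2r ?(orlicz_ge0 oPhi)//.
rewrite -expRM (mulNr (eta *+ n)) expRN ler_pdivlMr ?expR_gt0//; apply: le_trans rhon.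
by rewrite /rho expr_div_n mulrC mulrnAl -mulr_natr expRM_natr (mulrC eta).
Qed.

(** The previous lemma with the scale l written as 2 (c a)^gamma, where a is
    the size of the cubes used for averaging: the decay factor kappa then beats
    the volume factor a^N, whatever the constant K. *)
Lemma orlicz_small_cube (N : nat) (gamma c K : R) : (0 < N)%N -> 0 < gamma ->
  N%:R / gamma < p_minus Phi -> 0 < c -> 0 < K ->
  exists a kappa : R, [/\ 0 < a, 0 <= kappa, K * kappa <= a ^+ N &
    forall t : R, 0 <= t -> Phi (2 * (c * a) `^ gamma * t) <= kappa * Phi t].
Proof.
move=> N0 g0 dp c0 K0; set d := N%:R / gamma in dp.
have d0 : 0 < d by rewrite divr_gt0// ltr0n.
have h0 : 0 < (2^-1 : R) `^ d by rewrite powR_gt0// invr_gt0.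
pose eps := c ^- N * 2^-1 `^ d / K.
have eps0 : 0 < eps by rewrite divr_gt0 ?mulr_gt0 ?invr_gt0 ?exprn_gt0.
have [|l l0 Hl] := @orlicz_decay d eps _ eps0; first by rewrite d0.
have l20 : 0 <= l / 2 by rewrite divr_ge0 ?ltW.
exists (c^-1 * (l / 2) `^ gamma^-1), (eps * l `^ d); split => //.
- by apply: mulr_gt0; [rewrite invr_gt0|exact/powR_gt0/divr_gt0].
- by rewrite mulr_ge0 ?powR_ge0 ?ltW.
- rewrite exprMn exprVn -(powR_mulrn N (powR_ge0 _ _)) -powRrM.
  rewrite (mulrC gamma^-1) -/d.
  rewrite powRM ?invr_ge0 ?(ltW l0)//.
  rewrite [leLHS](_ : _ = c ^- N * (l `^ d * 2^-1 `^ d))// /eps; field.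
  by rewrite !gt_eqF// exprn_gt0.
- move=> t t0; rewrite (_ : 2 * _ = l); first exact: Hl.
  rewrite mulVKf ?gt_eqF// -powRrM mulVf ?gt_eqF// powRr1//.
  by field.
Qed.

End orlicz_decay.

(** When the exponents p_minus Psi are bounded, their supremum is at least
    p_minus Phi >= 1 > 0, so that the hypothesis can be solved for it. The
    remaining case, where sup takes its default value 0 and the hypothesis reads
    0 < gamma, is direct: some exponent exceeds c / gamma. *)
Lemma p_ominus_witness {R : realType} (Phi : R -> R) (c gamma : R) :
  orlicz_function Phi -> 0 < c -> c / p_ominus Phi < gamma ->
  0 < gamma /\ exists Psi,
    [/\ orlicz_function Psi, orlicz_equiv Psi Phi & c / gamma < p_minus Psi].
Proof.
move=> oPhi c0; rewrite /p_ominus; set S := [set p_minus _ | _ in _] => hp.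
have SPhi : S (p_minus Phi).
  exists Phi => //; split => //; exists 1, 1; split => // t _.
  by rewrite mul1r.
have S0 : S !=set0 by exists (p_minus Phi).
have found x : S x -> c / gamma < x -> exists Psi,
    [/\ orlicz_function Psi, orlicz_equiv Psi Phi & c / gamma < p_minus Psi].
  by move=> [Psi [oPsi ePsi] <-] ?; exists Psi.
have [ubS|nubS] := pselect (has_ubound S).
  have p0 : 0 < sup S.
    apply: (@lt_le_trans _ _ (p_minus Phi)); last exact: ub_le_sup.
    exact: lt_le_trans ltr01 (p_minus_ge1 oPhi).
  have g0 : 0 < gamma by apply: lt_trans hp; exact: divr_gt0.
  split=> //; have : c / gamma < sup S by rewrite ltr_pdivrMr// mulrC -ltr_pdivrMr.
  by move=> /(sup_gt S0)[x Sx]; exact: found Sx.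
have g0 : 0 < gamma.
  by move: hp; rewrite sup_out ?invr0 ?mulr0// => -[].
split=> //; apply: contrapT => nex; apply: nubS; exists (c / gamma) => x Sx.
by rewrite leNgt; apply/negP => /(found _ Sx).
Qed.

(** * Measurability and the Euclidean norm on row vectors *)

Section rV_measurability.
Context {R : realType} {n : nat}.

Lemma measurable_rV_box (A : 'I_n -> set R) : (forall i, measurable (A i)) ->
  measurable [set x : 'rV[R]_n | forall i, A i (x ord0 i)].
Proof.
move=> mA; rewrite (_ : mkset _ = \bigcap_(i in [set: 'I_n])
    (fun x : 'rV[R]_n => x ord0 i) @^-1` A i); last first.
  by apply/seteqP; split=> x h i //=; exact: h.
apply: fin_bigcap_measurable => // i _; rewrite -[X in measurable X]setTI.
exact: (measurable_coord i measurableT (mA _)).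
Qed.

(** The sigma-algebra generated by the coordinates contains the open sets
    because rational boxes form a countable base. *)
Lemma open_rV_measurable (U : set 'rV[R]_n) : open U -> measurable U.
Proof.
move=> oU.
pose B (ck : 'rV[rat]_n * nat) : set 'rV[R]_n := [set x |
  forall i, ball (ratr (ck.1 ord0 i) : R) (ck.2.+1%:R^-1) (x ord0 i)].
have -> : U = \bigcup_ck (if `[< B ck `<=` U >] then B ck else set0).
  apply/seteqP; split=> [x Ux|x [ck _]]; last by case: asboolP => // BU /BU.
  have /nbhs_ballP[e /= e0 xeU] : nbhs x U by exact: open_nbhs_nbhs.
  have [k ke] : exists k : nat, k.+1%:R^-1 < e / 2.
    have [k _ /(_ k (leqnn k)) H] :=
      near_infty_natSinv_lt (PosNum (divr_gt0 e0 (ltr0n R 2))).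
    by exists k.
  have k0 : 0 < k.+1%:R^-1 :> R by rewrite invr_gt0.
  have /choice[q xq] : forall i, exists q : rat,
      ball (ratr q : R) (k.+1%:R^-1) (x ord0 i).
    move=> i.
    have [|q] :=
      @rat_in_itvoo R (x ord0 i - k.+1%:R^-1) (x ord0 i + k.+1%:R^-1).
      by rewrite ltrD2l gtrN.
    rewrite in_itv/= => /andP[q1 q2]; exists q.
    rewrite /ball/= ltr_norml.
    by move: (x ord0 i) (k.+1%:R^-1) q1 q2 => a b; lra.
  exists (\row_i q i, k) => //.
  have Bx : B (\row_i q i, k) x.
    by move=> i /=; rewrite mxE; exact: xq.
  case: asboolP => // -[] y By; apply: xeU; split => // i j.
  rewrite ord1; have := By j; have := Bx j; rewrite /ball/= mxE => {By Bx k0}.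
  rewrite !ltr_norml; move: (k.+1%:R^-1) ke => b; lra.
apply: countable_bigcupT_measurable => [|ck].
  exact: (@countableP ('rV[rat]_n * nat)%type).
case: ifPn => // _; apply: (@measurable_rV_box
  (fun i => ball (ratr (ck.1 ord0 i) : R) (ck.2.+1%:R^-1))) => i.
by apply: open_measurable; exact: ball_open.
Qed.

Lemma continuous_rV_measurable (f : 'rV[R]_n -> R) :
  continuous f -> measurable_fun setT f.
Proof.
move=> /continuousP cf; apply: (measurability _ (RGenOpens.measurableE R)).
move=> _ [_ [a [b ->] <-]]; rewrite setTI; apply: open_rV_measurable.
exact/cf/interval_open.
Qed.

Lemma measurable_enorm : measurable_fun setT (@enorm R n).
Proof.
rewrite (_ : @enorm R n = fun x => (\sum_i x ord0 i ^+ 2) `^ 2^-1); last first.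
  by apply/funext => x; rewrite powR12_sqrt// sumr_ge0// => i _; exact: sqr_ge0.
apply: (measurableT_comp (measurable_powR _)).
by apply: measurable_sum => i; apply: measurable_funX; exact: measurable_coord.
Qed.

Lemma enorm_ge0 (x : 'rV[R]_n) : 0 <= enorm x.
Proof. exact: sqrtr_ge0. Qed.

Lemma ler_coord_enorm (x : 'rV[R]_n) i : `|x ord0 i| <= enorm x.
Proof.
rewrite -sqrtr_sqr ler_sqrt; last by rewrite sumr_ge0// => j _; exact: sqr_ge0.
by rewrite (bigD1 i)//= lerDl sumr_ge0// => j _; exact: sqr_ge0.
Qed.

Lemma enorm_le (x : 'rV[R]_n) b : 0 <= b -> (forall i, `|x ord0 i| <= b) ->
  enorm x <= Num.sqrt n%:R * b.
Proof.
move=> b0 xb; rewrite -[b in leRHS](ger0_norm b0) -sqrtr_sqr -sqrtrM// ler_sqrt.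
  rewrite -[n in n%:R]card_ord mulr_natl -sumr_const; apply: ler_sum => i _.
  by rewrite -real_normK ?num_real// lerXn2r ?nnegrE.
by rewrite mulr_ge0// sqr_ge0.
Qed.

Lemma enorm_eq0 (x : 'rV[R]_n) : enorm x = 0 -> x = 0.
Proof.
move=> x0; apply/rowP => i; rewrite mxE; apply/eqP.
by rewrite -normr_le0 -x0 ler_coord_enorm.
Qed.

Lemma enorm0 : enorm (0 : 'rV[R]_n) = 0.
Proof. by rewrite /enorm big1 ?sqrtr0// => i _; rewrite mxE expr0n. Qed.

Lemma enorm_gt0 (x : 'rV[R]_n) : x != 0 -> 0 < enorm x.
Proof.
move=> x0; rewrite lt_neqAle enorm_ge0 andbT eq_sym.
by apply: contra_neq x0 => /enorm_eq0.
Qed.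

Definition rV_cube (a b : R) : set 'rV[R]_n :=
  [set x | forall i, `]a, b]%classic (x ord0 i)].

Lemma measurable_rV_cube a b : measurable (rV_cube a b).
Proof. exact: (@measurable_rV_box (fun=> `]a, b]%classic)). Qed.

Lemma lebesgue_rV_cube a b : a <= b ->
  lebesgue_rV n (rV_cube a b) = ((b - a) ^+ n)%:E.
Proof.
move=> ab; rewrite (@lebesgue_rV_box _ _ (fun=> `]a, b]%classic))//.
rewrite -[n in RHS]card_ord -prodr_const -prodEFin; apply: eq_bigr => i _.
rewrite lebesgue_measure_itv/= lte_fin.
by case: ltgtP ab => // -> _; rewrite subrr.
Qed.

End rV_measurability.

(** * Continuity of test functions and finiteness of the energy *)

(** Differentiability is available away from 0 only; near 0 the function
    vanishes, as 0 lies outside the closed support. *)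
Lemma Cc1_continuous {R : realType} N (u : 'rV[R]_N -> R) :
  Cc1 [set x | x != 0] u -> continuous u.
Proof.
move=> [du _ _ suppu] x; have [->|x0] := eqVneq x 0; last first.
  exact/differentiable_continuous/du.
have oK : open (~` closure [set y | u y != 0]).
  by apply: closed_openC; exact: closed_closure.
have K0 : (~` closure [set y | u y != 0]) (0 : 'rV[R]_N).
  by move/suppu => /=; rewrite eqxx.
have u0 y : (~` closure [set y | u y != 0]) y -> u y = 0.
  by move=> Ky; apply: contrapT => /eqP uy; apply: Ky; exact: subset_closure.
rewrite /continuous_at u0//; apply: (cvg_near_cst 0 (F := nbhs (0 : 'rV[R]_N))).
by apply: filterS u0 _; exact: open_nbhs_nbhs.
Qed.

Section energy.
Context {R : realType} {Phi : R -> R} (oPhi : orlicz_function Phi).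
Variables (N : nat) (gamma : R) (u : 'rV[R]_N -> R).
Hypothesis Cu : Cc1 [set x | x != 0] u.

Let E x := Phi (`|u x| / enorm x `^ gamma).

Lemma energy_ge0 x : 0 <= E x.
Proof. by apply: (orlicz_ge0 oPhi); rewrite divr_ge0// powR_ge0. Qed.

Lemma measurable_energy : measurable_fun setT E.
Proof.
apply: (measurable_orlicz_comp oPhi (f := fun x => `|u x| / enorm x `^ gamma)).
  by move=> x; rewrite divr_ge0// powR_ge0.
under eq_fun do rewrite -powRN.
apply: measurable_funM.
  apply: measurableT_comp => //.
  exact: continuous_rV_measurable (Cc1_continuous Cu).
exact: (measurableT_comp (measurable_powR _) measurable_enorm).
Qed.

(** Finiteness is what allows the energy to be absorbed into itself. The
    density is bounded and supported in a cube, as u is bounded with compact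
    support and enorm x is bounded below on the support. *)
Lemma energy_lty : 0 <= gamma ->
  (\int[lebesgue_rV N]_x (E x)%:E < +oo)%E.
Proof.
move=> g0; have [_ _ cK sK] := Cu; set K := closure _ in cK sK.
have uK x : ~ K x -> u x = 0.
  by move=> Kx; apply: contrapT => /eqP ux; apply: Kx; exact: subset_closure.
have [M [_ HM]] := compact_bounded cK.
have cuK : {within K, continuous u}.
  exact: continuous_subspaceT (Cc1_continuous Cu).
have [B [_ HB]] := compact_bounded (continuous_compact cuK cK).
have [e /= e0 eK] : nbhs_ball (0 : 'rV[R]_N) (~` K).
  apply/nbhs_ballP; apply: open_nbhs_nbhs; split.
    by apply: closed_openC; exact: closed_closure.
  by move/sK => /=; rewrite eqxx.
have Kge x : K x -> e <= enorm x.
  move=> Kx; rewrite leNgt; apply/negP => xe; apply: (eK x) => //; split => // i j.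
  by rewrite ord1 mxE /ball/= add0r normrN (le_lt_trans (ler_coord_enorm _ _)).
have KB x : K x -> `|u x| <= `|B| + 1.
  move=> Kx; apply: (HB (`|B| + 1)); last by exists x.
  by rewrite (le_lt_trans (ler_norm _))// ltrDl.
have KM x i : K x -> `|x ord0 i| < `|M| + 2.
  move=> Kx; have : `|x| < `|M| + 2.
    apply: (@le_lt_trans _ _ (`|M| + 1)); last by rewrite ltrD2l ltr1n.
    by apply: (HM (`|M| + 1)) => //; rewrite (le_lt_trans (ler_norm _))// ltrDl.
  rewrite -normrN -sub0r => xb.
  have [_ /(_ ord0 i)] : ball (0 : 'rV[R]_N) (`|M| + 2) x by rewrite -ball_normE.
  by rewrite mxE /ball/= sub0r normrN.
pose b := `|M| + 2.
pose Q : set 'rV[R]_N := rV_cube (- b) b.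
pose m := Phi ((`|B| + 1) / e `^ gamma).
have m0 : 0 <= m.
  by apply: (orlicz_ge0 oPhi); rewrite divr_ge0 ?powR_ge0// addr_ge0.
have mQ : measurable Q by exact: measurable_rV_cube.
apply: (@le_lt_trans _ _ (\int[lebesgue_rV N]_x (m%:E * (\1_Q x)%:E))%E).
  apply: ge0_le_integral => //=.
  - by move=> x _; rewrite lee_fin; exact: energy_ge0.
  - by apply/measurable_EFinP; exact: measurable_energy.
  - by apply: measurable_funeM; exact/measurable_EFinP/measurable_indic.
  - move=> x _; rewrite -EFinM lee_fin.
    have [Kx|/uK ux] := pselect (K x); last first.
      by rewrite /E ux normr0 mul0r (orlicz0 oPhi) mulr_ge0.
    rewrite indicE mem_set ?mulr1.
      apply: (orlicz_homo oPhi); first by rewrite divr_ge0 ?powR_ge0.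
      apply: ler_pM; rewrite ?invr_ge0 ?powR_ge0 ?KB//.
      rewrite lef_pV2 ?posrE ?powR_gt0//; last exact: lt_le_trans (Kge _ Kx).
      by rewrite ge0_ler_powR ?nnegrE ?(ltW e0) ?enorm_ge0// Kge.
    move=> i /=; rewrite in_itv/=.
    by have := KM x i Kx; rewrite ltr_norml -/b => /andP[-> /ltW].
rewrite ge0_integralZl_EFin//; last exact/measurable_EFinP/measurable_indic.
rewrite integral_indic// setIT -[X in (_ * X)%E]/(lebesgue_rV N (rV_cube (- b) b)).
rewrite lebesgue_rV_cube; first by rewrite -EFinM ltry.
by rewrite /b; have := normr_ge0 M; lra.
Qed.

End energy.

(** * The averaging kernel *)

Section cube_kernel.
Context {R : realType} (N : nat) (a : R).
Hypotheses (N0 : (0 < N)%N) (a0 : 0 < a).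

(** The uniform density of a cube of side a |x| situated at distance of order
    a |x| from the origin: averaging against it moves a point x towards 0 by a
    factor of order a. *)
Definition cube_kernel (x y : 'rV[R]_N) : R :=
  \1_(rV_cube (a * enorm x) (2 * (a * enorm x))) y / (a * enorm x) ^+ N.

Lemma cube_kernel_ge0 x y : 0 <= cube_kernel x y.
Proof.
by rewrite mulr_ge0// invr_ge0 exprn_ge0// mulr_ge0 ?(ltW a0)// enorm_ge0.
Qed.

Lemma measurable_cube_kernel :
  measurable_fun setT (fun z : 'rV[R]_N * 'rV[R]_N => cube_kernel z.1 z.2).
Proof.
have mr : measurable_fun setT (fun z : 'rV[R]_N * 'rV[R]_N => a * enorm z.1).
  apply: measurable_funM => //.
  exact: (measurableT_comp measurable_enorm measurable_fst).
have my i : measurable_fun setT (fun z : 'rV[R]_N * 'rV[R]_N => z.2 ord0 i).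
  exact: (measurableT_comp (measurable_coord i) measurable_snd).
apply: measurable_funM; last first.
  have ar0 (z : 'rV[R]_N * 'rV[R]_N) : 0 <= a * enorm z.1.
    by rewrite mulr_ge0 ?(ltW a0)// enorm_ge0.
  under eq_fun do rewrite -powR_invn//.
  exact: (measurableT_comp (measurable_powR _)).
pose T := \bigcap_(i in [set: 'I_N])
  ((fun z : 'rV[R]_N * 'rV[R]_N => z.2 ord0 i - a * enorm z.1)
     @^-1` `]0, +oo[ `&`
   (fun z : 'rV[R]_N * 'rV[R]_N => 2 * (a * enorm z.1) - z.2 ord0 i)
     @^-1` `[0, +oo[).
have mT : measurable T.
  apply: fin_bigcap_measurable => // i _; apply: measurableI.
    rewrite -[X in measurable X]setTI.
    by apply: (measurable_funB (my i) mr) => //; exact: measurable_itv.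
  have m2 : measurable_fun setT
      (fun z : 'rV[R]_N * 'rV[R]_N => 2 * (a * enorm z.1) - z.2 ord0 i).
    by apply: measurable_funB => //; exact: measurable_funM.
  by rewrite -[X in measurable X]setTI; apply: m2 => //; exact: measurable_itv.
rewrite (_ : (fun _ => _) = \1_T); first exact: measurable_indic.
apply/funext => z; rewrite !indicE; congr (_%:R); congr nat_of_bool.
apply/idP/idP; rewrite !inE.
  move=> h i _; have := h i; rewrite /= !in_itv/= !andbT subr_gt0 subr_ge0.
  by move=> /andP[].
move=> h i; have := h i I; rewrite /= !in_itv/= !andbT subr_gt0 subr_ge0.
by move=> [-> ->].
Qed.

Lemma cube_kernel0 y : cube_kernel 0 y = 0.
Proof.
rewrite /cube_kernel indicE memNset ?mul0r// => /(_ (Ordinal N0)).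
by rewrite /= enorm0 !mulr0 in_itv/= => /andP[/lt_le_trans H /H]; rewrite ltxx.
Qed.

Lemma integral_cube_kernel_r x : x != 0 ->
  (\int[lebesgue_rV N]_y (cube_kernel x y)%:E = 1)%E.
Proof.
move=> x0; have r0 : 0 < a * enorm x by rewrite mulr_gt0// enorm_gt0.
rewrite /cube_kernel; under eq_integral do rewrite mulrC EFinM.
have mQ := @measurable_rV_cube R N (a * enorm x) (2 * (a * enorm x)).
rewrite ge0_integralZl_EFin//; last 2 first.
- exact/measurable_EFinP/measurable_indic.
- by rewrite invr_ge0 exprn_ge0// ltW.
rewrite integral_indic// setIT.
rewrite -[X in (_ * X)%E]/(lebesgue_rV N
  (rV_cube (a * enorm x) (2 * (a * enorm x)))).
rewrite lebesgue_rV_cube; last by lra.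
rewrite -EFinM (_ : 2 * _ - _ = a * enorm x); last by ring.
by rewrite mulVf// gt_eqF// exprn_gt0.
Qed.

(** If y lies in the cube attached to x and t is a coordinate of y, then
    t / (2 a) <= |x| < t / a. So x stays in a cube of side 2 t / a, on which the
    density is at most (2 / t)^N. *)
Lemma integral_cube_kernel_l y :
  (\int[lebesgue_rV N]_x (cube_kernel x y)%:E <= ((4 / a) ^+ N)%:E)%E.
Proof.
pose t := y ord0 (Ordinal N0).
have supp x : rV_cube (a * enorm x) (2 * (a * enorm x)) y ->
    a * enorm x < t /\ t <= 2 * (a * enorm x).
  by move=> /(_ (Ordinal N0)) /=; rewrite in_itv/= => /andP.
have [t0|t0] := leP t 0.
  rewrite integral0_eq; first by rewrite lee_fin exprn_ge0// divr_ge0// ltW.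
  move=> x _; rewrite /cube_kernel indicE memNset ?mul0r// => /supp[xt _].
  have := enorm_ge0 x; rewrite leNgt -(pmulr_rlt0 _ a0) => /negP; apply.
  exact: lt_le_trans t0.
pose rho := t / a; have rho0 : 0 < rho by exact: divr_gt0.
have mQ := @measurable_rV_cube R N (- rho) rho.
apply: (@le_trans _ _ (\int[lebesgue_rV N]_x
    (((2 / t) ^+ N)%:E * (\1_(rV_cube (- rho) rho) x)%:E))%E).
  apply: ge0_le_integral => //=.
  - by move=> x _; rewrite lee_fin cube_kernel_ge0.
  - apply/measurable_EFinP.
    exact: (measurableT_comp measurable_cube_kernel (pair2_measurable y)).
  - by apply: measurable_funeM; exact/measurable_EFinP/measurable_indic.
  - move=> x _; rewrite -EFinM lee_fin /cube_kernel !indicE.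
    have [/[!inE] /supp[xt tx]|] := boolP (y \in _); last first.
      by rewrite mul0r mulr_ge0// exprn_ge0// divr_ge0// ltW.
    have r0 : 0 < a * enorm x by lra.
    have xr : enorm x < rho by rewrite ltr_pdivlMr// mulrC.
    rewrite mem_set ?mulr1 ?mul1r.
      rewrite -exprVn lerXn2r ?nnegrE ?divr_ge0 ?invr_ge0 ?(ltW t0) ?(ltW r0)//.
      by rewrite -[leLHS]mul1r ler_pdivrMr// mulrAC ler_pdivlMr// mul1r.
    move=> i /=; have := le_lt_trans (ler_coord_enorm x i) xr.
    by rewrite ltr_norml in_itv/= => /andP[-> /ltW].
rewrite ge0_integralZl_EFin//; last 2 first.
- exact/measurable_EFinP/measurable_indic.
- by rewrite exprn_ge0// divr_ge0// ltW.
rewrite integral_indic// setIT.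
rewrite -[X in (_ * X)%E]/(lebesgue_rV N (rV_cube (- rho) rho)).
rewrite lebesgue_rV_cube; last by lra.
rewrite -EFinM lee_fin -exprMn /rho.
by rewrite (_ : 2 / t * _ = 4 / a)//; field; rewrite !gt_eqF.
Qed.

End cube_kernel.

(** * Absorption of an averaged term *)

Lemma ge0_le_integral_scale {R : realType} d (T : measurableType d)
    (m : {measure set T -> \bar R}) (f g : T -> R) (c : R) :
  0 <= c -> (forall x, 0 <= f x) -> (forall x, 0 <= g x) ->
  measurable_fun setT f -> measurable_fun setT g ->
  (forall x, f x <= c * g x) ->
  (\int[m]_x (f x)%:E <= c%:E * \int[m]_x (g x)%:E)%E.
Proof.
move=> c0 f0 g0 mf mg fg; rewrite -ge0_integralZl_EFin//; last 2 first.
- by move=> x _; rewrite lee_fin.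
- by apply/measurable_EFinP; exact: mg.
apply: ge0_le_integral => //.
- by move=> x _; rewrite lee_fin.
- by apply/measurable_EFinP; exact: mf.
- by apply: measurable_funeM; apply/measurable_EFinP; exact: mg.
- by move=> x _; rewrite -EFinM lee_fin.
Qed.

(** Integrating the pointwise bound over T * T: where E does not vanish the
    kernel has mass 1 in its second variable, so the left side gives the
    integral I of E; the kernel has mass at most B in its first variable, so the
    last term gives at most kappa B I <= I / 2, which is absorbed because I is
    finite. *)
Lemma kernel_absorption {R : realType} d (T : measurableType d)
    (m : {sigma_finite_measure set T -> \bar R})
    (k G : T -> T -> R) (E : T -> R) (C kappa B : R) :
  (forall x y, 0 <= k x y) -> (forall x y, 0 <= G x y) ->
  (forall x, 0 <= E x) -> 0 < C -> 0 <= kappa -> 0 <= B ->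
  measurable_fun setT (fun z : T * T => k z.1 z.2) ->
  measurable_fun setT (fun z : T * T => G z.1 z.2) ->
  measurable_fun setT E ->
  (forall x, E x != 0 -> (\int[m]_y (k x y)%:E = 1)%E) ->
  (forall y, (\int[m]_x (k x y)%:E <= B%:E)%E) ->
  (forall x y, k x y * E x <= C * G x y + kappa * (k x y * E y)) ->
  kappa * B <= 2^-1 ->
  (\int[m]_x (E x)%:E < +oo)%E ->
  (\int[m]_x (E x)%:E <= (2 * C)%:E * \int[m \x m]_z (G z.1 z.2)%:E)%E.
Proof.
move=> k0 G0 E0 C0 kappa0 B0 mk mG mE k_r k_l kEG kB.
set I := (\int[m]_x (E x)%:E)%E; set J := (\int[m \x m]_z _)%E => Ioo.
have I0 : (0 <= I)%E by apply: integral_ge0 => x _; rewrite lee_fin.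
have J0 : (0 <= J)%E by apply: integral_ge0 => z _; rewrite lee_fin.
have kE0 x y z : 0 <= k x y * E z by exact: mulr_ge0.
have mkx x : measurable_fun setT (fun y => (k x y)%:E).
  by apply/measurable_EFinP; exact: (measurableT_comp mk (pair1_measurable x)).
have mky y : measurable_fun setT (fun x => (k x y)%:E).
  by apply/measurable_EFinP; exact: (measurableT_comp mk (pair2_measurable y)).
have mE1 : measurable_fun setT (fun z : T * T => k z.1 z.2 * E z.1).
  by apply: measurable_funM => //; exact: (measurableT_comp mE measurable_fst).
have mE2 : measurable_fun setT (fun z : T * T => k z.1 z.2 * E z.2).
  by apply: measurable_funM => //; exact: (measurableT_comp mE measurable_snd).
have I1 : (\int[m \x m]_z (k z.1 z.2 * E z.1)%:E = I)%E.
  rewrite (@fubini_tonelli1 _ _ _ _ _ _ _ (fun z => (k z.1 z.2 * E z.1)%:E)).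
  - apply: eq_integral => x _; rewrite /fubini_F/=.
    have [->|Ex] := eqVneq (E x) 0.
      by rewrite integral0_eq// => y _; rewrite mulr0.
    under eq_integral do rewrite mulrC EFinM.
    rewrite ge0_integralZl_EFin ?k_r ?mule1//.
    by move=> y _; rewrite lee_fin.
  - by apply/measurable_EFinP; exact: mE1.
  - by move=> z; rewrite lee_fin.
have I2 : (\int[m \x m]_z (k z.1 z.2 * E z.2)%:E <= B%:E * I)%E.
  have mE2' : measurable_fun setT (fun z : T * T => (k z.1 z.2 * E z.2)%:E).
    by apply/measurable_EFinP; exact: mE2.
  rewrite (@fubini_tonelli2 _ _ _ _ _ _ _ (fun z => (k z.1 z.2 * E z.2)%:E))//;
    last by move=> z; rewrite lee_fin.
  rewrite -ge0_integralZl_EFin//; last 2 first.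
  - by move=> x _; rewrite lee_fin.
  - by apply/measurable_EFinP; exact: mE.
  apply: ge0_le_integral => //.
  - by move=> y _; apply: integral_ge0 => x _; rewrite lee_fin.
  - apply: (@measurable_fun_fubini_tonelli_G _ _ _ _ _ m
      (fun z => (k z.1 z.2 * E z.2)%:E)) => //.
    by move=> z; rewrite lee_fin.
  - by apply: measurable_funeM; apply/measurable_EFinP; exact: mE.
  move=> y _; rewrite /fubini_G/=.
  under eq_integral do rewrite mulrC EFinM.
  rewrite ge0_integralZl_EFin//; last by move=> x _; rewrite lee_fin.
  by rewrite muleC lee_wpmul2r ?lee_fin.
have le_abs : (I <= C%:E * J + (kappa * B)%:E * I)%E.
  rewrite -{1}I1.
  apply: (@le_trans _ _ (\int[m \x m]_z ((C * G z.1 z.2)%:E +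
     (kappa * (k z.1 z.2 * E z.2))%:E))%E).
    apply: ge0_le_integral => //.
    - by move=> z _; rewrite lee_fin.
    - by apply/measurable_EFinP; exact: mE1.
    - by apply: emeasurable_funD; apply/measurable_EFinP; exact: measurable_funM.
    - by move=> z _; rewrite -EFinD lee_fin.
  rewrite ge0_integralD//; last 4 first.
  - by move=> z _; rewrite lee_fin mulr_ge0// ltW.
  - by apply/measurable_EFinP; exact: measurable_funM.
  - by move=> z _; rewrite lee_fin mulr_ge0.
  - by apply/measurable_EFinP; exact: measurable_funM.
  under eq_integral do rewrite EFinM.
  rewrite ge0_integralZl_EFin//; last 3 first.
  - by move=> z _; rewrite lee_fin.
  - by apply/measurable_EFinP; exact: mG.
  - exact: ltW.
  rewrite leeD2l//; under eq_integral do rewrite EFinM.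
  rewrite ge0_integralZl_EFin//; last 2 first.
  - by move=> z _; rewrite lee_fin.
  - by apply/measurable_EFinP; exact: mE2.
  by rewrite EFinM -muleA lee_wpmul2l ?lee_fin.
have [->|Joo] := eqVneq J +oo%E.
  by rewrite gt0_muley ?leey// lte_fin mulr_gt0.
have Ifin : I \is a fin_num by rewrite ge0_fin_numE.
have Jfin : J \is a fin_num by rewrite ge0_fin_numE// ltey.
move: I0 le_abs; rewrite -(fineK Ifin) -(fineK Jfin) -!EFinM -EFinD !lee_fin.
move=> I0.
have : kappa * B * fine I <= 2^-1 * fine I by rewrite ler_wpM2r.
by lra.
Qed.

(** * Comparison of the densities *)

(** The sign of alpha decides which of the two comparisons is used; the sum of
    the two constants covers both cases. *)
Lemma powR_le_two_sided {R : realType} (a b r eta alpha : R) :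
  0 < a -> 0 < b -> 0 < r -> a * r <= eta -> eta <= b * r ->
  r `^ alpha <= (a `^ (- alpha) + b `^ (- alpha)) * eta `^ alpha.
Proof.
move=> a0 b0 r0 ae eb; have ar0 : 0 < a * r by exact: mulr_gt0.
have eta0 : 0 < eta by exact: lt_le_trans ae.
have br0 : 0 < b * r by exact: lt_le_trans eb.
have E c : 0 < c -> r `^ alpha = c `^ (- alpha) * (c * r) `^ alpha.
  move=> c0; rewrite powRM ?(ltW c0) ?(ltW r0)// mulrA.
  rewrite -powRD ?addNr ?powRr0 ?mul1r//.
  by rewrite (gt_eqF c0) implybT.
rewrite mulrDl; have [al|al] := leP 0 alpha.
  rewrite (E a)// ler_wpDr ?mulr_ge0 ?powR_ge0// ler_wpM2l ?powR_ge0//.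
  by rewrite ge0_ler_powR// nnegrE ltW.
rewrite [leLHS](E b)// ler_wpDl ?mulr_ge0 ?powR_ge0// ler_wpM2l ?powR_ge0//.
rewrite -[alpha]opprK [leLHS]powRN [leRHS]powRN lef_pV2 ?posrE ?powR_gt0//.
by rewrite ge0_ler_powR ?nnegrE ?oppr_ge0// ltW.
Qed.

Section comparison_of_weights.
Context {R : realType}.
Implicit Types a b c d r v eta s gamma alpha : R.

(** The weights |x|^-gamma and |x|^alpha1 |y|^alpha2 |x - y|^-s have the same
    homogeneity, so they are comparable as soon as r = |x|, eta = |y| and an
    upper bound for d = |x - y| are. *)
Lemma oscillation_weight_le a b c d r v eta s alpha1 alpha2 :
  0 < a -> 0 < b -> 0 <= c -> 0 < r -> 0 < d -> 0 <= v -> 0 <= s ->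
  a * r <= eta -> eta <= b * r -> d <= c * r ->
  2 * v / r `^ (s - alpha1 - alpha2) <=
  2 * c `^ s * (a `^ (- alpha2) + b `^ (- alpha2)) *
    (r `^ alpha1 * eta `^ alpha2 * (v / d `^ s)).
Proof.
move=> a0 b0 c0 r0 d0 v0 s0 ae eb dc.
have ds : d `^ s <= c `^ s * r `^ s.
  rewrite -powRM ?(ltW r0)//.
  by rewrite ge0_ler_powR ?nnegrE ?(ltW d0)// mulr_ge0// ltW.
have ra := powR_le_two_sided alpha2 a0 b0 r0 ae eb.
have -> : (r `^ (s - alpha1 - alpha2))^-1 = r `^ alpha1 * (r `^ alpha2 / r `^ s).
  rewrite -powRN -powRB ?(gt_eqF r0) ?implybT//.
  rewrite -powRD ?(gt_eqF r0) ?implybT//.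
  by congr (_ `^ _); ring.
have ds0 : 0 < d `^ s by exact: powR_gt0.
have rs0 : 0 < r `^ s by exact: powR_gt0.
have := powR_ge0 r alpha1; have := powR_ge0 r alpha2.
move: (c `^ s) (r `^ s) (d `^ s) (r `^ alpha1) (r `^ alpha2) (eta `^ alpha2)
  (a `^ _ + _) ds ra ds0 rs0 => C S D A B E K ds ra ds0 rs0 B0 A0.
have key : B / S <= K * C * E / D.
  rewrite ler_pdivlMr// mulrAC ler_pdivrMr//.
  rewrite (le_trans (ler_pM B0 (ltW ds0) ra ds))//.
  by rewrite le_eqVlt; apply/orP; left; apply/eqP; ring.
have vA0 : 0 <= 2 * v * A by rewrite !mulr_ge0.
rewrite mulrA; apply: le_trans (ler_wpM2l vA0 key) _.
by rewrite le_eqVlt; apply/orP; left; apply/eqP; ring.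
Qed.

Lemma kernel_weight_le a c d r N : 0 < a -> 0 < r -> 0 < d -> d <= c * r ->
  (a * r) ^- N <= (c / a) ^+ N / d ^+ N.
Proof.
move=> a0 r0 d0 dc; have cr0 : 0 < c * r by exact: lt_le_trans dc.
have c0 : 0 < c by rewrite -(pmulr_lgt0 _ r0).
have ar0 : 0 < a * r by exact: mulr_gt0.
rewrite -exprVn -expr_div_n lerXn2r ?nnegrE ?invr_ge0 ?divr_ge0 ?(ltW ar0) ?(ltW d0)
  ?(ltW c0) ?(ltW a0)//.
rewrite ler_pdivlMr// mulrC ler_pdivrMr//.
by rewrite (_ : c / a * (a * r) = c * r)//; field; rewrite gt_eqF.
Qed.

Lemma hardy_weight_le b r v eta gamma : 0 <= b -> 0 < r -> 0 < eta ->
  0 <= v -> 0 <= gamma -> eta <= b * r ->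
  2 * v / r `^ gamma <= 2 * b `^ gamma * (v / eta `^ gamma).
Proof.
move=> b0 r0 eta0 v0 g0 eb.
have : eta `^ gamma <= b `^ gamma * r `^ gamma.
  rewrite -powRM ?(ltW r0)//.
  by rewrite ge0_ler_powR ?nnegrE ?(ltW eta0)// mulr_ge0 ?(ltW r0).
have := powR_gt0 gamma eta0; have := powR_gt0 gamma r0.
move: (eta `^ gamma) (b `^ gamma) (r `^ gamma) => E B S S0 E0 EB.
rewrite ler_pdivrMr// (_ : _ * S = 2 * v * (B * S) / E); last by ring.
by rewrite ler_pdivlMr// ler_wpM2l// mulr_ge0.
Qed.

End comparison_of_weights.

Section hardy.
Context {R : realType} {Phi : R -> R} (oPhi : orlicz_function Phi).
Variables (N : nat) (s alpha1 alpha2 gamma : R).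
Hypotheses (N0 : (0 < N)%N) (s0 : 0 < s).
Hypothesis gammaE : gamma = s - alpha1 - alpha2.

Let hardy_density (u : 'rV[R]_N -> R) x := Phi (`|u x| / enorm x `^ gamma).
Let gagliardo_density (u : 'rV[R]_N -> R) (x y : 'rV[R]_N) :=
  Phi (enorm x `^ alpha1 * enorm y `^ alpha2 * `|Ds s u x y|)
    / enorm (x - y) ^+ N.

Lemma gagliardo_density_ge0 u x y : 0 <= gagliardo_density u x y.
Proof.
rewrite divr_ge0 ?exprn_ge0 ?enorm_ge0// (orlicz_ge0 oPhi)//.
by rewrite !mulr_ge0 ?powR_ge0.
Qed.

Lemma measurable_gagliardo_density (u : 'rV[R]_N -> R) :
  measurable_fun setT u ->
  measurable_fun setT
    (fun z : 'rV[R]_N * 'rV[R]_N => gagliardo_density u z.1 z.2).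
Proof.
move=> mu.
have m1 : measurable_fun setT (fun z : 'rV[R]_N * 'rV[R]_N => enorm z.1).
  exact: (measurableT_comp measurable_enorm measurable_fst).
have m2 : measurable_fun setT (fun z : 'rV[R]_N * 'rV[R]_N => enorm z.2).
  exact: (measurableT_comp measurable_enorm measurable_snd).
have md : measurable_fun setT (fun z : 'rV[R]_N * 'rV[R]_N => enorm (z.1 - z.2)).
  apply: (measurableT_comp measurable_enorm); apply: measurable_fun_coord => i.
  under eq_fun do rewrite !mxE.
  apply: measurable_funB.
    exact: (measurableT_comp (measurable_coord i) measurable_fst).
  exact: (measurableT_comp (measurable_coord i) measurable_snd).
rewrite /gagliardo_density /Ds.
apply: measurable_funM; last first.
  under eq_fun do rewrite -powR_invn ?enorm_ge0//.
  exact: (measurableT_comp (measurable_powR _)).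
apply: (measurable_orlicz_comp oPhi (f := fun z : 'rV[R]_N * 'rV[R]_N =>
   enorm z.1 `^ alpha1 * enorm z.2 `^ alpha2 *
   `|(u z.1 - u z.2) / enorm (z.1 - z.2) `^ s|)).
  by move=> z; rewrite !mulr_ge0 ?powR_ge0.
apply: measurable_funM.
  by apply: measurable_funM; exact: (measurableT_comp (measurable_powR _)).
apply: measurableT_comp => //; under eq_fun do rewrite -powRN.
apply: measurable_funM; last exact: (measurableT_comp (measurable_powR _)).
apply: measurable_funB.
  exact: (measurableT_comp mu measurable_fst).
exact: (measurableT_comp mu measurable_snd).
Qed.

(** The triangle inequality |u x| <= |u x - u y| + |u y| and convexity split the
    density at x into an oscillation, which is a piece of the Gagliardo density
    since |x|, |y| and |x - y| are comparable up to constants depending on a,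
    and the density at y damped by kappa, since |y| / |x| is of order a. *)
Lemma hardy_pointwise (a kappa : R) : 0 < a -> 0 <= kappa ->
  (forall t : R, 0 <= t ->
     Phi (2 * (2 * Num.sqrt N%:R * a) `^ gamma * t) <= kappa * Phi t) ->
  0 <= gamma ->
  exists2 C : R, 0 < C & forall (u : 'rV[R]_N -> R) x y,
    cube_kernel a x y * hardy_density u x <=
    C * gagliardo_density u x y +
    kappa * (cube_kernel a x y * hardy_density u y).
Proof.
move=> a0 kappa0 decay g0.
pose rN : R := Num.sqrt N%:R; have rN0 : 0 < rN by rewrite sqrtr_gt0 ltr0n.
pose b := 2 * rN * a; have b0 : 0 < b by rewrite !mulr_gt0.
pose c := rN * (1 + 2 * a).
have c0 : 0 < c by rewrite mulr_gt0// addr_gt0// mulr_gt0.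
pose M := 2 * c `^ s * (a `^ (- alpha2) + b `^ (- alpha2)).
have M0 : 0 <= M by rewrite !mulr_ge0 ?addr_ge0 ?powR_ge0.
have [C1 C10 PC1] := orlicz_le_mul oPhi M0.
exists (C1 * (c / a) ^+ N).
  by apply: mulr_gt0 => //; exact/exprn_gt0/divr_gt0.
move=> u x y; have hd0 z : 0 <= hardy_density u z.
  by rewrite (orlicz_ge0 oPhi)// divr_ge0 ?powR_ge0.
have C0 : 0 <= C1 * (c / a) ^+ N.
  by rewrite mulr_ge0 ?exprn_ge0 ?divr_ge0// ltW.
have gd0 := gagliardo_density_ge0 u x y.
have [->|x0] := eqVneq x 0.
  rewrite (cube_kernel0 _ N0) mul0r (mul0r (hardy_density u y)) mulr0 addr0.
  exact: mulr_ge0 (gagliardo_density_ge0 _ _ _).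
set r := enorm x; have r0 : 0 < r by exact: enorm_gt0.
have [yS|yS] := boolP (y \in rV_cube (a * r) (2 * (a * r))); last first.
  have -> : cube_kernel a x y = 0 by rewrite /cube_kernel indicE (negbTE yS) mul0r.
  by rewrite mul0r (mul0r (hardy_density u y)) mulr0 addr0; exact: mulr_ge0 gd0.
have ar0 : 0 < a * r by exact: mulr_gt0.
have arN0 : 0 < (a * r) ^- N by rewrite invr_gt0 exprn_gt0.
have -> : cube_kernel a x y = (a * r) ^- N by rewrite /cube_kernel indicE yS mul1r.
have yi i : a * r < y ord0 i /\ y ord0 i <= 2 * (a * r).
  by move: yS; rewrite inE => /(_ i) /=; rewrite in_itv/= => /andP.
set eta := enorm y.
have eta_ge : a * r <= eta.
  apply: le_trans (ler_coord_enorm y (Ordinal N0)).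
  by rewrite (le_trans _ (ler_norm _))// ltW// (yi _).1.
have eta_le : eta <= b * r.
  rewrite /b (_ : 2 * rN * a * r = rN * (2 * (a * r))); last by ring.
  apply: enorm_le => [|i]; first by lra.
  by have := yi i; rewrite ler_norml; lra.
have eta0 : 0 < eta by exact: lt_le_trans eta_ge.
set d := enorm (x - y).
have d_le : d <= c * r.
  rewrite /c -mulrA; apply: enorm_le => [|i]; first by rewrite mulr_ge0//; lra.
  have := ler_coord_enorm x i; have := yi i; rewrite !mxE -/r !ler_norml; lra.
have osc : Phi (2 * `|u x - u y| / r `^ gamma) * (a * r) ^- N <=
    C1 * (c / a) ^+ N * gagliardo_density u x y.
  have [xy|xy] := eqVneq x y.
    rewrite -xy subrr normr0 mulr0 mul0r (orlicz0 oPhi) mul0r.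
    by rewrite mulr_ge0// gagliardo_density_ge0.
  have d0 : 0 < d by rewrite enorm_gt0// subr_eq0.
  rewrite /gagliardo_density -/d -/r -/eta.
  set g := _ * `|Ds s u x y|.
  have g_ge0 : 0 <= g by rewrite !mulr_ge0 ?powR_ge0.
  have arg : 2 * `|u x - u y| / r `^ gamma <= M * g.
    rewrite /g /Ds normrM normfV (ger0_norm (powR_ge0 _ _)) gammaE.
    exact: (oscillation_weight_le _ _ a0 b0 (ltW c0) r0 d0 _ (ltW s0)).
  have dN := kernel_weight_le N a0 r0 d0 d_le.
  apply: le_trans (ler_pM _ _ (le_trans (orlicz_homo oPhi _ arg) (PC1 _ g_ge0)) dN) _.
  - by rewrite (orlicz_ge0 oPhi)// divr_ge0 ?mulr_ge0 ?powR_ge0.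
  - exact: ltW.
  - by rewrite divr_ge0 ?mulr_ge0 ?powR_ge0.
  - by rewrite le_eqVlt; apply/orP; left; apply/eqP; ring.
have tail : Phi (2 * `|u y| / r `^ gamma) <= kappa * hardy_density u y.
  apply: le_trans (decay _ _); last by rewrite divr_ge0 ?powR_ge0.
  apply: (orlicz_homo oPhi); first by rewrite divr_ge0 ?mulr_ge0 ?powR_ge0.
  exact: (hardy_weight_le (ltW b0) r0 eta0 _ g0 eta_le).
have split : hardy_density u x <=
    Phi (2 * `|u x - u y| / r `^ gamma) + Phi (2 * `|u y| / r `^ gamma).
  set A := 2 * _ / _; set B := 2 * `|u y| / _.
  have A0 : 0 <= A by rewrite divr_ge0 ?mulr_ge0 ?powR_ge0.
  have B0 : 0 <= B by rewrite divr_ge0 ?mulr_ge0 ?powR_ge0.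
  apply: (@le_trans _ _ (Phi (2^-1 * A + (1 - 2^-1) * B))).
    apply: (orlicz_homo oPhi); first by rewrite divr_ge0 ?powR_ge0.
    rewrite (_ : _ + _ = (`|u x - u y| + `|u y|) / r `^ gamma); last first.
      by rewrite /A /B; field; rewrite gt_eqF// powR_gt0.
    rewrite ler_wpM2r ?invr_ge0 ?powR_ge0//.
    by rewrite -{1}[u x](subrK (u y)) ler_normD.
  have h01 : (0 <= (2^-1 : R)) && ((2^-1 : R) <= 1).
    by rewrite invr_ge0 ler0n invf_le1 ?ler1n ?ltr0n.
  apply: le_trans (orlicz_conv oPhi h01 A0 B0) _.
  have := orlicz_ge0 oPhi A0; have := orlicz_ge0 oPhi B0; lra.
rewrite (le_trans (ler_wpM2l (ltW arN0) split))// mulrDr lerD//.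
  by rewrite mulrC.
by rewrite mulrCA; exact: ler_wpM2l (ltW arN0) _ _ tail.
Qed.

Lemma orlicz_hardy_p_minus : N%:R / gamma < p_minus Phi -> 0 < gamma ->
  exists2 C : R, 0 < C & forall u : 'rV[R]_N -> R, Cc1 [set x | x != 0] u ->
    (\int[lebesgue_rV N]_x (hardy_density u x)%:E <=
     C%:E * \int[lebesgue_rV N \x lebesgue_rV N]_z
       (gagliardo_density u z.1 z.2)%:E)%E.
Proof.
move=> pN g0.
have rN0 : 0 < 2 * Num.sqrt N%:R :> R by rewrite mulr_gt0// sqrtr_gt0 ltr0n.
have K0 : 0 < 2 * 4 ^+ N :> R by rewrite mulr_gt0// exprn_gt0.
have [a [kappa [a0 kappa0 ka decay]]] := orlicz_small_cube oPhi N0 g0 pN rN0 K0.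
have [C C0 HC] := hardy_pointwise a0 kappa0 decay (ltW g0).
exists (2 * C) => [|u Cu]; first exact: mulr_gt0.
apply: (@kernel_absorption _ _ _ (lebesgue_rV N) (@cube_kernel R N a)
  (gagliardo_density u) (hardy_density u) C kappa ((4 / a) ^+ N)).
- exact: cube_kernel_ge0.
- exact: gagliardo_density_ge0.
- exact: (energy_ge0 oPhi).
- exact: C0.
- exact: kappa0.
- by rewrite exprn_ge0// divr_ge0// ltW.
- exact: measurable_cube_kernel.
- apply: measurable_gagliardo_density.
  exact: continuous_rV_measurable (Cc1_continuous Cu).
- exact: (measurable_energy oPhi gamma Cu).
- move=> x Ex; apply: integral_cube_kernel_r => //.
  apply: contra_neq Ex => ->; rewrite /hardy_density (_ : u 0 = 0).
    by rewrite normr0 mul0r (orlicz0 oPhi).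
  apply: contrapT => /eqP u0; have [_ _ _ suppu] := Cu.
  have /suppu/= : closure [set x | u x != 0] 0 by exact: subset_closure.
  by rewrite eqxx.
- exact: integral_cube_kernel_l.
- exact: HC.
(* The factor 4^N / a^N of the kernel is compensated by kappa. *)
- rewrite expr_div_n mulrA ler_pdivrMr ?exprn_gt0//.
  by rewrite -ler_pdivrMl ?invr_gt0// invrK mulrA mulrAC.
- exact: (energy_lty oPhi Cu (ltW g0)).
Qed.

End hardy.

Theorem theorem1p3 (R : realType) (N : nat) (s alpha1 alpha2 gamma : R)
    (Phi : R -> R) (hN : (1 <= N)%N) (hs : 0 < s < 1)
    (hgamma : gamma = s - alpha1 - alpha2) (hPhi : orlicz_function Phi)
    (hp : gamma > N%:R / p_ominus Phi) :
  exists2 C : R, 0 < C & forall u : 'rV[R]_N -> R, Cc1 [set x | x != 0] u ->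
    (\int[lebesgue_rV N]_x (Phi (`|u x| / enorm x `^ gamma))%:E <=
     C%:E * \int[lebesgue_rV N \x lebesgue_rV N]_z
       (Phi (enorm z.1 `^ alpha1 * enorm z.2 `^ alpha2 * `|Ds s u z.1 z.2|)
         / enorm (z.1 - z.2) ^+ N)%:E)%E.
Proof.
have c0 : 0 < N%:R :> R by rewrite ltr0n.
have [g0 [Psi [oPsi [C1 [C2 [C10 C20 PsiPhi]]] pPsi]]] :=
  p_ominus_witness hPhi c0 hp.
have s0 : 0 < s by case/andP: hs.
have [C C0 HC] := orlicz_hardy_p_minus oPsi hN s0 hgamma pPsi g0.
exists (C2 * C / C1) => [|u Cu]; first by rewrite !(mulr_gt0, invr_gt0).
have mu := continuous_rV_measurable (Cc1_continuous Cu).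
have m_phi := measurable_energy hPhi gamma Cu.
have m_psi := measurable_energy oPsi gamma Cu.
have mg_phi := measurable_gagliardo_density hPhi s alpha1 alpha2 mu.
have mg_psi := measurable_gagliardo_density oPsi s alpha1 alpha2 mu.
have C210 : 0 <= C2 * C by rewrite mulr_ge0 // ltW.
apply: le_trans (ge0_le_integral_scale (lebesgue_rV N) (ltW C20)
  (energy_ge0 hPhi gamma u) (energy_ge0 oPsi gamma u) m_phi m_psi _) _.
  by move=> x; apply: (PsiPhi _ _).2; rewrite divr_ge0 ?powR_ge0.
apply: le_trans (lee_wpmul2l _ (HC u Cu)) _; first by rewrite lee_fin ltW.
rewrite muleA -EFinM [in leRHS]EFinM -[leRHS]muleA.
apply: lee_wpmul2l; first by rewrite lee_fin.
apply: (ge0_le_integral_scale (lebesgue_rV N \x lebesgue_rV N)%E _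
  (fun z => gagliardo_density_ge0 oPsi s alpha1 alpha2 u z.1 z.2)
  (fun z => gagliardo_density_ge0 hPhi s alpha1 alpha2 u z.1 z.2) mg_psi mg_phi).
  by rewrite invr_ge0 ltW.
move=> z; rewrite mulrA ler_wpM2r ?invr_ge0 ?exprn_ge0 ?enorm_ge0//.
rewrite ler_pdivlMl//; apply: (PsiPhi _ _).1.
by rewrite !mulr_ge0 ?powR_ge0.
Qed.
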